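(* Let $L_1=P_0+\sum_{i=1}^nP_i x_i \in \mathbb{S}\mathbb{R}^{d\times d}[x]$ be a diagonal linear polynomial such that the set $D_{L_1}(1)=\{x\in\mathbb{R}^n\mid L_1(x)\succeq 0\}$ is an $n$-simplex. If the linear polynomial $L_2=R_0+\sum_{i=1}^nR_i x_i \in \mathbb{S}\mathbb{R}^{\ell\times \ell}[x]$ satisfies $L_2|_{D_{L_1}(1)}\succeq 0$ (that is, $L_2(x)$ is positive semidefinite for every $x\in D_{L_1}(1)$), then there exist finitely many constant matrices $A_j\in \mathbb{R}^{\ell\times \ell}$ and $B_k\in \mathbb{R}^{d\times \ell}$ such that $$L_2=\sum_j A^{\ast}_jA_j+ \sum_k B^{\ast}_k L_1 B_k.$$
   Context: Let $x=(x_1,\ldots,x_n)$ be commuting real variables. $\mathbb{S}\mathbb{R}^{d\times d}[x]$ denotes the set of polynomials in $x$ whose coefficients are symmetric real $d\times d$ matrices; so the $P_i$ are real symmetric $d\times d$ matrices and the $R_i$ real symmetric $\ell\times\ell$ matrices. $L_1$ is diagonal if all its coefficients $P_i$ are diagonal matrices. An $n$-simplex in $\mathbb{R}^n$ is the convex hull of $n+1$ affinely independent points. $M^\ast$ is the transpose of $M$. $\succeq 0$ means positive semidefinite. *)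

(* Defs.v *)
From HB Require Import structures.
From mathcomp Require Import all_boot all_order all_algebra.
From mathcomp Require Import classical_sets reals.
From mathcomp Require Import mpoly.

Set Implicit Arguments.
Unset Strict Implicit.
Unset Printing Implicit Defensive.

Import Order.TTheory GRing.Theory Num.Theory.

Local Open Scope classical_set_scope.
Local Open Scope ring_scope.

(* Polynomials in n commuting variables with m x m matrix coefficients are
   represented as m x m matrices of scalar polynomials. *)

Definition constmx (R : comNzRingType) (n m k : nat) (M : 'M[R]_(m, k)) :
    'M[{mpoly R[n]}]_(m, k) :=
  map_mx (@mpolyC n R) M.

Definition linpoly (R : comNzRingType) (n m : nat) (M0 : 'M[R]_m)
    (M : 'I_n -> 'M[R]_m) : 'M[{mpoly R[n]}]_m :=
  constmx n M0 + \sum_(i < n) 'X_i *: constmx n (M i).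

Definition evalmx (R : comNzRingType) (n m : nat) (L : 'M[{mpoly R[n]}]_m)
    (x : 'rV[R]_n) : 'M[R]_m :=
  map_mx (meval (x ord0)) L.

Definition psd (R : realType) (m : nat) (M : 'M[R]_m) : Prop :=
  M^T = M /\ forall v : 'cV[R]_m, 0 <= (v^T *m M *m v) ord0 ord0.

(* D_L(1): the scalar level of the matrix-variable domain of L. *)
Definition psd_set (R : realType) (n m : nat) (L : 'M[{mpoly R[n]}]_m) :
    set 'rV[R]_n :=
  [set x | psd (evalmx L x)].

Definition affinely_independent (R : realType) (n k : nat)
    (v : 'I_k -> 'rV[R]_n) : Prop :=
  forall c : 'I_k -> R,
    \sum_(i < k) c i = 0 -> \sum_(i < k) c i *: v i = 0 -> forall i, c i = 0.

Definition convex_hull (R : realType) (n k : nat) (v : 'I_k -> 'rV[R]_n) :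
    set 'rV[R]_n :=
  [set x | exists c : 'I_k -> R,
    [/\ forall i, 0 <= c i, \sum_(i < k) c i = 1 & x = \sum_(i < k) c i *: v i]].

Definition is_simplex (R : realType) (n : nat) (S : set 'rV[R]_n) : Prop :=
  exists v : 'I_n.+1 -> 'rV[R]_n, affinely_independent v /\ S = convex_hull v.

(* Main.v *)
Require Import Defs.
From HB Require Import structures.
From mathcomp Require Import all_boot all_order all_algebra.
From mathcomp Require Import classical_sets reals.
From mathcomp Require Import mpoly.

Set Implicit Arguments.
Unset Strict Implicit.
Unset Printing Implicit Defensive.

Import Order.TTheory GRing.Theory Num.Theory.

Local Open Scope ring_scope.

(** A linear matrix polynomial is determined by its values at n + 1 affinely
    independent points, so it is enough to find a right-hand side that agrees
    with L2 at the vertices v_0, ..., v_n of the simplex (affine_mx_ext).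

    Let lambda_i be the barycentric coordinates of the simplex.  Every facet
    lambda_i = 0 lies in the zero set of some diagonal entry of L1: the simplex
    is cut out by the finitely many inequalities expressing that these entries
    are nonnegative, and a point just outside the facet, near its barycenter,
    must violate one of them however close it is.  The violated entry vanishes
    at the barycenter, hence at all vertices of the facet, and is positive at
    the opposite vertex v_i (facet_entry).  So that entry, say number k_i, is a
    positive multiple of lambda_i.

    Each L2(v_i) is positive semidefinite, hence a Gram matrix C_i^T C_i
    (psd_gram), and L2 is the sum of the lambda_i C_i^T C_i.  A product
    C^T f C, with f the k-th diagonal entry of L1, is a sum of terms B^T L1 B
    whose matrices B carry one row of C in position k (gram_expansion); with
    lambda_i rescaled from that entry this is the certificate, and it needs
    no constant squares A_j.  The exception is n = 0, where the only facet is
    empty and has no barycenter; there L2 is the constant C^T C. *)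

(** * Positive semidefinite matrices *)

Section PositiveSemidefinite.
Variables (R : realType) (m : nat).
Implicit Types M N C : 'M[R]_m.

Lemma psd_congr M N : psd M -> psd (N^T *m M *m N).
Proof.
move=> [Msym Mge0]; split; first by rewrite !trmx_mul trmxK Msym mulmxA.
by move=> v; have := Mge0 (N *m v); rewrite trmx_mul !mulmxA.
Qed.

Lemma delta_mulmx_delta M i j :
  ((delta_mx i 0 : 'cV[R]_m)^T *m M *m (delta_mx j 0 : 'cV[R]_m)) 0 0 = M i j.
Proof. by rewrite trmx_delta -rowE -colE !mxE. Qed.

Lemma psd_diag_ge0 M i : psd M -> 0 <= M i i.
Proof. by move=> [_ /(_ (delta_mx i 0))]; rewrite delta_mulmx_delta. Qed.

(** Otherwise the quadratic form at t e_i + e_j, which is affine in t with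
    slope 2 M_ij, would take negative values. *)
Lemma psd_diag_eq0 M i j : psd M -> M i i = 0 -> M i j = 0.
Proof.
move=> [Msym Mge0] Mii0; apply/eqP/negPn/negP => Mij0.
have Mji : M j i = M i j by rewrite -[in LHS]Msym mxE.
(* At this t the form takes the value -1. *)
pose t := - (M j j + 1) / (M i j *+ 2).
have := Mge0 (t *: delta_mx i 0 + delta_mx j 0).
rewrite [(_ + _)^T]linearD /= [(_ *: _)^T]linearZ /= !mulmxDl !mulmxDr.
rewrite -!scalemxAl -!scalemxAr.
rewrite ![fun_of_matrix (_ + _) _ _]mxE ![fun_of_matrix (_ *: _) _ _]mxE.
rewrite !delta_mulmx_delta Mii0 Mji.
rewrite !mulr0 add0r addrA -mulr2n -mulrnAr /t divfK; last first.
  by rewrite mulrn_eq0.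
by rewrite opprD addrAC addNr add0r lerNr oppr0 ler10.
Qed.

(** Symmetric Gaussian elimination: subtracting r^T r / M_ii, with r the row
    of a nonzero pivot M_ii, leaves a positive semidefinite matrix with fewer
    nonzero diagonal entries.  The clause on zero rows makes the square root of
    the remainder orthogonal to the one-row square root of the subtracted part,
    so that their sum is again a square matrix with the right Gram matrix. *)
Lemma psd_gram M : psd M ->
  exists C, M = C^T *m C /\ forall i, M i i = 0 -> row i C = 0.
Proof.
have [k] := ubnP #|[pred i | M i i != 0]|; elim: k M => // k IHk M leMk psdM.
case: (pickP [pred i | M i i != 0]) => [i /= Mii0 | M0]; last first.
  exists 0; split=> [|i _]; last by rewrite row0.
  rewrite mulmx0; apply/matrixP => i j; rewrite mxE.
  by apply: psd_diag_eq0 => //; have /negbFE/eqP := M0 i.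
have Msym : M^T = M by case: psdM.
set a := M i i in Mii0 *.
have a_gt0 : 0 < a by rewrite lt_def Mii0 psd_diag_ge0.
pose e : 'cV[R]_m := delta_mx i 0; pose r := row i M.
have eM : e^T *m M = r by rewrite trmx_delta -rowE.
have Me : M *m e = r^T by rewrite -eM trmx_mul trmxK Msym.
have re : r *m e = a%:M.
  by apply/matrixP => x y; rewrite !ord1 -eM delta_mulmx_delta !mxE.
pose M' := M - a^-1 *: (r^T *m r).
have psdM' : psd M'.
  (* The congruence is the projection along e onto the M-orthogonal
     complement of e. *)
  suff -> : M' = (1%:M - a^-1 *: (e *m r))^T *m M *m (1%:M - a^-1 *: (e *m r)).
    exact: psd_congr.
  rewrite [(_ - _)^T]linearB /= [(_ *: _)^T]linearZ /= trmx1 trmx_mul.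
  rewrite mulmxBl mul1mx mulmxBr mulmx1.
  rewrite -scalemxAl -[r^T *m e^T *m M]mulmxA eM -scalemxAr mulmxBl mulmxA Me.
  rewrite -!scalemxAl -[r^T *m r *m _]mulmxA (mulmxA r) re mul_scalar_mx.
  by rewrite -scalemxAr !scalerA mulVf // scale1r subrr scaler0 subr0.
have M'E x y : M' x y = M x y - a^-1 * (M i x * M i y).
  by rewrite !mxE big_ord1 !mxE.
have M'ii : M' i i = 0 by rewrite M'E -/a mulrA mulVf // mul1r subrr.
have M'0 j : M j j = 0 -> M' j j = 0.
  move=> Mjj0; rewrite M'E Mjj0 -Msym mxE (psd_diag_eq0 i psdM Mjj0).
  by rewrite mul0r mulr0 subr0.
have [|C [M'C C0]] := IHk M' _ psdM'.
  rewrite -ltnS; apply: leq_trans leMk; rewrite ltnS; apply/proper_card/properP.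
  split; last by exists i; rewrite !inE ?M'ii ?eqxx.
  by apply/fintype.subsetP => j; rewrite !inE; apply: contraNneq => /M'0 ->.
pose E := (Num.sqrt a)^-1 *: (e *m r).
have CE : C^T *m E = 0.
  rewrite -scalemxAr mulmxA -[C^T *m e]trmxK trmx_mul trmxK trmx_delta -rowE.
  by rewrite C0 // trmx0 mul0mx scaler0.
have EE : E^T *m E = a^-1 *: (r^T *m r).
  rewrite [(_ *: _)^T]linearZ /= -scalemxAl -scalemxAr scalerA -invfM -expr2.
  rewrite sqr_sqrtr ?ltW // trmx_mul -mulmxA (mulmxA e^T) trmx_delta.
  by rewrite mul_delta_mx [delta_mx 0 0](_ : _ = 1%:M) ?mul1mx //;
    apply/matrixP => x y; rewrite !ord1 !mxE.
exists (C + E); split=> [|j Mjj0].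
  rewrite [(_ + _)^T]linearD /= mulmxDl !mulmxDr CE addr0.
  by rewrite -[E^T *m C]trmxK trmx_mul trmxK CE
    trmx0 add0r EE -M'C subrK.
rewrite [row _ (_ + _)]linearD /= C0 ?M'0 // add0r [row _ _]linearZ /= rowE.
rewrite mulmxA mul_delta_mx_0 ?mul0mx ?scaler0 //.
by apply: contraNneq Mii0 => ji; rewrite /a -ji Mjj0.
Qed.

Lemma diag_psdP M : is_diag_mx M -> psd M <-> forall i, 0 <= M i i.
Proof.
move=> /is_diag_mxP Mdiag; split=> [psdM i|Mge0]; first exact: psd_diag_ge0.
split.
  apply/matrixP => i j; rewrite mxE; have [->//|ij] := eqVneq i j.
  by rewrite !Mdiag // eq_sym.
move=> v; rewrite mxE sumr_ge0 // => j _; rewrite mxE (bigD1 j) //= big1.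
  by rewrite addr0 mxE mulrAC -expr2 mulr_ge0 ?sqr_ge0.
by move=> i ij; rewrite Mdiag ?mulr0.
Qed.

End PositiveSemidefinite.

(** * Linear matrix polynomials and their values *)

Section AffineMatrixPolynomials.
Variables (R : realType) (n : nat).

Definition affine_mx m (L : 'M[{mpoly R[n]}]_m) :=
  exists M0 M, L = linpoly M0 M.

Lemma evalmx_const m k (M : 'M[R]_(m, k)) (x : 'rV[R]_n) :
  map_mx (meval (x ord0)) (constmx n M) = M.
Proof. by apply/matrixP => i j; rewrite !mxE mevalC. Qed.

Lemma evalmx_linpoly m M0 (M : 'I_n -> 'M[R]_m) x :
  evalmx (linpoly M0 M) x = M0 + \sum_i x ord0 i *: M i.
Proof.
rewrite /evalmx map_mxD evalmx_const raddf_sum; congr (_ + _).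
by apply: eq_bigr => i _; rewrite /= map_mxZ /= mevalXU evalmx_const.
Qed.

Lemma affine_combination m (L : 'M_m) k (c : 'I_k -> R) (v : 'I_k -> 'rV[R]_n) :
  affine_mx L -> \sum_j c j = 1 ->
  evalmx L (\sum_j c j *: v j) = \sum_j c j *: evalmx L (v j).
Proof.
move=> [M0 [M ->]] c1; rewrite evalmx_linpoly.
under [RHS]eq_bigr do rewrite evalmx_linpoly scalerDr scaler_sumr.
rewrite big_split /= -scaler_suml c1 scale1r exchange_big /=; congr (_ + _).
apply: eq_bigr => i _; rewrite summxE scaler_suml.
by apply: eq_bigr => j _; rewrite mxE scalerA.
Qed.

Lemma affine_mx_const m (M : 'M[R]_m) : affine_mx (constmx n M).
Proof.
exists M, (fun=> 0); rewrite /linpoly big1 ?addr0 // => i _.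
by rewrite /constmx raddf0 scaler0.
Qed.

Lemma affine_mx_add m (L L' : 'M[{mpoly R[n]}]_m) :
  affine_mx L -> affine_mx L' -> affine_mx (L + L').
Proof.
move=> [M0 [M ->]] [N0 [N ->]]; exists (M0 + N0), (fun i => M i + N i).
rewrite /linpoly /constmx map_mxD addrACA -big_split /=; congr (_ + _).
by apply: eq_bigr => i _; rewrite map_mxD scalerDr.
Qed.

Lemma affine_mx_sum m (I : finType) (L : I -> 'M[{mpoly R[n]}]_m) :
  (forall i, affine_mx (L i)) -> affine_mx (\sum_i L i).
Proof.
move=> affL; elim/big_ind: _ => //; last exact: affine_mx_add.
by rewrite -(raddf0 (map_mx (@mpolyC n R))); apply: affine_mx_const.
Qed.

Lemma affine_mx_congr m k (L : 'M[{mpoly R[n]}]_m) (B : 'M_(m, k)) :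
  affine_mx L -> affine_mx ((constmx n B)^T *m L *m constmx n B).
Proof.
move=> [M0 [M ->]]; exists (B^T *m M0 *m B), (fun i => B^T *m M i *m B).
rewrite /linpoly /constmx mulmxDr mulmxDl !map_mxM map_trmx; congr (_ + _).
rewrite mulmx_sumr mulmx_suml; apply: eq_bigr => i _.
by rewrite -scalemxAr -scalemxAl !map_mxM.
Qed.

(** The matrix V with rows (1, v_i) is invertible by affine independence, and
    it kills, for each position (a, b), the column of coefficients of the
    difference. *)
Lemma affine_mx_ext m (L L' : 'M[{mpoly R[n]}]_m) (v : 'I_n.+1 -> 'rV[R]_n) :
  affinely_independent v -> affine_mx L -> affine_mx L' ->
  (forall i, evalmx L (v i) = evalmx L' (v i)) -> L = L'.
Proof.
move=> indep [M0 [M ->]] [N0 [N ->]] eqv.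
pose V : 'M[R]_(n.+1, 1 + n) := row_mx (const_mx 1) (\matrix_i v i).
have Vunit : V \in unitmx.
  rewrite -row_free_unit -kermx_eq0; apply/eqP/row_matrixP => i.
  have /sub_kermxP := row_sub i (kermx V).
  set u := row i _; rewrite mul_mx_row => uV0.
  have [u1 uv] := eq_row_mx (etrans uV0 (esym (row_mx0 _ _ _ _))).
  rewrite row0; apply/rowP => j; rewrite [RHS]mxE.
  apply: (indep (fun j => u ord0 j)) => {j}.
    move/matrixP/(_ ord0 ord0): u1; rewrite !mxE => u1; rewrite -[RHS]u1.
    by apply: eq_bigr => j _; rewrite [const_mx _ _ _]mxE mulr1.
  rewrite -[RHS]uv mulmx_sum_row; apply: eq_bigr => j _.
  by rewrite rowK.
have eqMN a b : (M0 - N0) a b = 0 /\ forall k, (M k - N k) a b = 0.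
  pose w : 'cV[R]_(1 + n) :=
    col_mx ((M0 - N0) a b)%:M (\col_k (M k - N k) a b).
  suff w0 : w = 0.
    have [/matrixP h0 /matrixP h] :=
      eq_col_mx (etrans w0 (esym (col_mx0 _ _ _ _))).
    split=> [|k]; first by have := h0 0 0; rewrite !mxE.
    by have := h k 0; rewrite !mxE.
  rewrite -(mulKmx Vunit w) (_ : V *m w = 0) ?mulmx0 //.
  rewrite mul_row_col; apply/colP => i; rewrite [RHS]mxE.
  have /matrixP/(_ a b) := eqv i; rewrite !evalmx_linpoly => /eqP.
  rewrite -subr_eq0 ![fun_of_matrix (_ + _) _ _]mxE !summxE => /eqP h.
  rewrite -[RHS]h !mxE big_ord1 !mxE mul1r mulr1n opprD addrACA -sumrB; congr (_ + _).
  by apply: eq_bigr => k _; rewrite !mxE mulrBr.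
have -> : M0 = N0.
  by apply/matrixP => a b; have [/eqP] := eqMN a b; rewrite !mxE subr_eq0 => /eqP.
rewrite /linpoly; congr (_ + _); apply: eq_bigr => k _; congr (_ *: constmx n _).
apply/matrixP => a b; have [_ /(_ k)/eqP] := eqMN a b.
by rewrite !mxE subr_eq0 => /eqP.
Qed.

End AffineMatrixPolynomials.

(** * Facets of a simplex given by diagonal inequalities *)

Section Facets.
Variables (R : realType) (n : nat).

Lemma affine_coord_uniq k (v : 'I_k -> 'rV[R]_n) (c c' : 'I_k -> R) :
  affinely_independent v -> \sum_j c j = \sum_j c' j ->
  \sum_j c j *: v j = \sum_j c' j *: v j -> c =1 c'.
Proof.
move=> indep eqc eqv j; apply/eqP; rewrite -subr_eq0; apply/eqP.
apply: (indep (fun j => c j - c' j)); first by rewrite sumrB eqc subrr.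
by under eq_bigr do rewrite scalerBl; rewrite sumrB eqv subrr.
Qed.

Lemma vertex_in_hull k (v : 'I_k -> 'rV[R]_n) i : convex_hull v (v i).
Proof.
exists (fun j => (j == i)%:R); split=> [j||]; first exact: ler0n.
  by rewrite (bigD1 i) //= eqxx big1 ?addr0 // => j /negbTE ->.
rewrite (bigD1 i) //= eqxx scale1r big1 ?addr0 // => j /negbTE ->.
by rewrite scale0r.
Qed.

(** The point with barycentric coordinates - eps at i and (1 + eps) / n
    elsewhere lies outside the simplex for every eps > 0.  If no diagonal entry
    had the required form, each entry positive at v_i would have a positive sum
    S over the vertices of the opposite facet, hence would stay nonnegative at
    that point for small eps, contradicting the description of the simplex. *)
Lemma facet_entry d (L : 'M[{mpoly R[n]}]_d) (v : 'I_n.+1 -> 'rV[R]_n) i :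
  (0 < n)%N -> affinely_independent v -> affine_mx L ->
  (forall x, convex_hull v x <-> forall k, 0 <= evalmx L x k k) ->
  exists k, 0 < evalmx L (v i) k k /\
    forall j, j != i -> evalmx L (v j) k k = 0.
Proof.
move=> n_gt0 indep affL hullP.
have f_ge0 j k : 0 <= evalmx L (v j) k k.
  by apply: (hullP _).1; apply: vertex_in_hull.
case: (pickP [pred k | (0 < evalmx L (v i) k k) &&
   [forall j, (j != i) ==> (evalmx L (v j) k k == 0)]])
  => [k /andP[fi fj]|noface].
  by exists k; split=> // j ji; apply/eqP; have /forallP/(_ j)/implyP := fj; apply.
exfalso.
pose S k := \sum_(j | j != i) evalmx L (v j) k k.
have S_ge0 k : 0 <= S k by apply: sumr_ge0.
have S_gt0 k : 0 < evalmx L (v i) k k -> 0 < S k.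
  move=> fi; rewrite lt_def S_ge0 andbT; apply/negP => /eqP Sk0.
  have := noface k; rewrite /= fi => /negbT/forallPn[j].
  by rewrite negb_imply => /andP[ji] /negP; apply; rewrite (psumr_eq0P _ Sk0).
(* Entry k is nonnegative at the point as soon as eps times its summand in T
   is at most 1, so eps := 1 / (1 + T) serves all k at once.  When S k = 0 the
   entry is 0 at v i by S_gt0, and the junk quotient 0 / 0 = 0 is harmless. *)
pose T := \sum_k n%:R * evalmx L (v i) k k / S k.
have T_ge0 k : 0 <= n%:R * evalmx L (v i) k k / S k.
  by rewrite divr_ge0 ?mulr_ge0.
pose eps := (1 + T)^-1.
have eps_gt0 : 0 < eps by rewrite invr_gt0 ltr_wpDr ?sumr_ge0.
have n0 : n%:R != 0 :> R by rewrite pnatr_eq0 -lt0n.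
pose c j : R := if j == i then - eps else (1 + eps) / n%:R.
have csum (V : lmodType R) (F : 'I_n.+1 -> V) : \sum_j c j *: F j
    = - eps *: F i + ((1 + eps) / n%:R) *: \sum_(j | j != i) F j.
  rewrite (bigD1 i) //= /c eqxx scaler_sumr; congr (_ + _).
  by apply: eq_bigr => j /negbTE ->.
have c1 : \sum_j c j = 1.
  have := csum R^o (fun=> 1).
  under eq_bigr do rewrite [_ *: _]mulr1.
  rewrite sumr_const cardC1 card_ord /= => ->.
  by rewrite /GRing.scale /= mulr1 divfK // addrC addrK.
suff /hullP [c' [c'_ge0 c'1 c'v]] : forall k, 0 <= evalmx L (\sum_j c j *: v j) k k.
  have := c'_ge0 i; rewrite -(affine_coord_uniq indep _ c'v) ?c1 //.
  by rewrite /c eqxx oppr_ge0 leNgt eps_gt0.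
move=> k; rewrite affine_combination // csum.
rewrite ![fun_of_matrix (_ + _) _ _]mxE ![fun_of_matrix (_ *: _) _ _]mxE.
rewrite summxE -/(S k) mulNr addrC subr_ge0.
have [fi0|fi0] := eqVneq (evalmx L (v i) k k) 0.
  by rewrite fi0 mulr0 mulr_ge0 // divr_ge0 ?addr_ge0 // ltW.
have Sk : 0 < S k by rewrite S_gt0 // lt_def fi0 f_ge0.
rewrite mulrAC ler_pdivlMr ?ltr0n // mulrDl mul1r.
have bound : eps * (n%:R * evalmx L (v i) k k / S k) <= 1.
  rewrite ler_pdivrMl ?mulr1; last by rewrite ltr_wpDr ?sumr_ge0.
  by rewrite /T (bigD1 k) //= addrCA lerDl addr_ge0 ?sumr_ge0.
apply: (@le_trans _ _ (S k)); last by rewrite lerDl mulr_ge0 ?ltW.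
by rewrite mulrAC -mulrA; move: bound; rewrite [eps * _]mulrA ler_pdivrMr // mul1r.
Qed.

End Facets.

(** * The certificate *)

(** Each row r of C, placed in row k of a d x l matrix, contributes
    D_kk (row r C)^T (row r C); off-diagonal entries of D are not seen. *)
Lemma gram_expansion (R : realType) d l (D : 'M[R]_d) (C : 'M[R]_l) k a :
  \sum_r (a *: (delta_mx k r *m C))^T *m D *m (a *: (delta_mx k r *m C))
  = (a ^+ 2 * D k k) *: (C^T *m C).
Proof.
have unitD (r : 'I_l) :
    (delta_mx k r)^T *m D *m delta_mx k r = D k k *: delta_mx r r.
  rewrite -(mul_delta_mx (0 : 'I_1)) trmx_mul trmx_delta -!mulmxA.
  rewrite (mulmxA D) (mulmxA _ (D *m _)) [_ *m (D *m _)](_ : _ = (D k k)%:M).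
    by rewrite mul_scalar_mx -scalemxAr mul_delta_mx.
  by apply/matrixP => x y; rewrite !ord1 mulmxA delta_mulmx_delta !mxE.
transitivity (\sum_r (a ^+ 2 * D k k) *: (C^T *m (delta_mx r r *m C))).
  apply: eq_bigr => r _.
  rewrite [(_ *: _)^T]linearZ /= -!scalemxAl -scalemxAr scalerA -expr2 -scalerA.
  congr (_ *: _); rewrite trmx_mul !mulmxA.
  rewrite -(mulmxA C^T _ D) -(mulmxA C^T _ (delta_mx k r)) unitD.
  by rewrite -scalemxAr -scalemxAl ?mulmxA.
rewrite -scaler_sumr -mulmx_sumr -mulmx_suml; congr (_ *: (_ *m _)).
rewrite -[RHS]mul1mx; congr (_ *m _); apply/matrixP => x y.
rewrite summxE !mxE (bigD1 x) //= mxE eqxx big1 ?addr0 //=.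
  by rewrite eq_sym.
by move=> r rx; rewrite mxE eq_sym (negbTE rx).
Qed.

Theorem theorem5 (R : realType) (n d l : nat)
    (P0 : 'M[R]_d) (P : 'I_n -> 'M[R]_d)
    (R0 : 'M[R]_l) (Q : 'I_n -> 'M[R]_l)
    (L1 : 'M[{mpoly R[n]}]_d) (L2 : 'M[{mpoly R[n]}]_l) :
  L1 = linpoly P0 P ->
  L2 = linpoly R0 Q ->
  P0^T = P0 -> (forall i, (P i)^T = P i) ->
  R0^T = R0 -> (forall i, (Q i)^T = Q i) ->
  is_diag_mx P0 -> (forall i, is_diag_mx (P i)) ->
  is_simplex (psd_set L1) ->
  (forall x, psd_set L1 x -> psd (evalmx L2 x)) ->
  exists (p q : nat) (A : 'I_p -> 'M[R]_l) (B : 'I_q -> 'M[R]_(d, l)),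
    L2 = \sum_(j < p) (constmx n (A j))^T *m constmx n (A j)
         + \sum_(k < q) (constmx n (B k))^T *m L1 *m constmx n (B k).
Proof.
move=> L1E L2E _ _ _ _ P0diag Pdiag [v [indep hullE]] L2psd.
have affL1 : affine_mx L1 by exists P0, P.
have affL2 : affine_mx L2 by exists R0, Q.
have L1diag x : is_diag_mx (evalmx L1 x).
  apply/is_diag_mxP => i j ij; rewrite L1E evalmx_linpoly mxE summxE.
  rewrite (is_diag_mxP P0diag) // add0r big1 // => k _.
  by rewrite mxE (is_diag_mxP (Pdiag k)) ?mulr0.
have hullP x : convex_hull v x <-> forall k, 0 <= evalmx L1 x k k.
  by rewrite -hullE; apply: diag_psdP.
have /fin_all_exists [C CE] i : exists C : 'M_l, evalmx L2 (v i) = C^T *m C.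
  have [|C [CE _]] := @psd_gram _ _ (evalmx L2 (v i)); last by exists C.
  by apply: L2psd; rewrite hullE; apply: vertex_in_hull.
have [n0|n_gt0] := posnP n.
  exists 1%N, 0%N, (fun=> C ord0), (fun=> 0).
  rewrite big_ord1 big_ord0 addr0 /constmx map_trmx -map_mxM.
  apply: (affine_mx_ext indep affL2 (affine_mx_const _ _)) => i.
  rewrite [RHS]evalmx_const -CE; congr (evalmx _ (v _)).
  by apply: val_inj; case: i => i /=; rewrite {1}n0; case: i.
have /fin_all_exists [k kP] i := facet_entry i n_gt0 indep affL1 hullP.
(* Rescales entry k i of L1 to the barycentric coordinate of vertex i. *)
pose a i := (Num.sqrt (evalmx L1 (v i) (k i) (k i)))^-1.
pose B (z : 'I_n.+1 * 'I_l) := a z.1 *: (delta_mx (k z.1) z.2 *m C z.1).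
exists 0%N, #|{: 'I_n.+1 * 'I_l}|, (fun=> 0), (fun s => B (enum_val s)).
rewrite big_ord0 add0r.
apply: (affine_mx_ext indep affL2).
  by apply: affine_mx_sum => s; apply: affine_mx_congr.
move=> j; pose G z := (B z)^T *m evalmx L1 (v j) *m B z.
(* The value at v j of the certificate, its terms grouped by vertex. *)
transitivity (\sum_i \sum_r G (i, r)); last first.
  rewrite pair_bigA (reindex (@enum_val _ {: 'I_n.+1 * 'I_l})) /=; last first.
    by apply: onW_bij; exists enum_rank; [apply: enum_valK | apply: enum_rankK].
  rewrite [RHS]raddf_sum; apply: eq_bigr => s _.
  by rewrite /= !map_mxM map_trmx !evalmx_const -surjective_pairing.
under [RHS]eq_bigr => i _ do
  rewrite (gram_expansion (evalmx L1 (v j)) (C i) (k i) (a i)).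
rewrite (bigD1 j) //= big1 ?addr0 => [|i ij].
  have [fj _] := kP j.
  by rewrite CE /a exprVn sqr_sqrtr ?ltW // mulVf ?scale1r // lt0r_neq0.
by have [_ -> //] := kP i; rewrite ?mulr0 ?scale0r // eq_sym.
Qed.
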